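(* Let $R = (V_R, A)$ be the Rado graph, with vertex set $V_R$ and adjacency matrix $A$. Let $(H,u)$ be a quantum automorphism of $R$, with $u = (u_{xy})_{x,y \in V_R}$, and let $x, y, s, t \in V_R$ be arbitrary. Then $u_{xy}$ and $u_{st}$ commute, i.e. $u_{xy}u_{st} = u_{st}u_{xy}$.
   Context: A quantum permutation of a set $X$ is a pair $\sigma = (H,u)$, where $H$ is a Hilbert space and $u = (u_{xy})_{x,y \in X}$ is a family of (orthogonal) projections in $B(H)$ such that for every $x \in X$ $$\sum_{y \in X} u_{xy} = \sum_{y \in X} u_{yx} = 1,$$ where convergence is in the strong operator topology, and such that for $(x,y) \neq (a,b)$ the projections $u_{xy}$ and $u_{ab}$ are orthogonal (i.e. $u_{xy}u_{ab}=0$) whenever $x = a$ or $y = b$. A quantum automorphism of a simple graph $X = (V_X, A)$, with vertex set $V_X$ and adjacency matrix $A$ (entries in $\{0,1\}$, symmetric, zero diagonal), is a quantum permutation $(H,u)$ of $V_X$ such that $u_{x_1y_1}u_{x_2y_2} = 0$ whenever $A_{x_1x_2} \neq A_{y_1y_2}$. The Rado graph $R = (V_R, A)$ is the unique (up to isomorphism) countable simple graph such that for any disjoint finite sets $U, V \subseteq V_R$ there exists a vertex $i \in V_R \setminus (U \cup V)$ with $A_{iu} = 1$ for all $u \in U$ and $A_{iv} = 0$ for all $v \in V$. *)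

(* Defs.v *)
From HB Require Import structures.
From mathcomp Require Import all_boot all_order all_algebra finmap complex.
From mathcomp Require Import all_classical all_reals all_analysis.
From mathcomp Require Import summability.

Set Implicit Arguments.
Unset Strict Implicit.
Unset Printing Implicit Defensive.

Import Order.TTheory GRing.Theory Num.Theory.
Import numFieldNormedType.Exports.

Local Open Scope classical_set_scope.
Local Open Scope ring_scope.
Local Open Scope complex_scope.

(* Complex Hilbert spaces; as {dot H for theta} is a form that is linear on the
   left, the inner product is conjugate-linear in its second argument. *)
HB.mixin Record CompleteNormedModule_isHilbert (R : realType) H
    & CompleteNormedModule R[i] H := {
  inner : {dot H for (@Num.conj R[i])} ;
  inner_norm : forall v : H, `|v| ^+ 2 = inner v v
}.

#[short(type="hilbertType")]
HB.structure Definition Hilbert (R : realType) :=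
  {H of CompleteNormedModule R[i] H & CompleteNormedModule_isHilbert R H}.

Section Operators.
Variables (R : realType) (H : hilbertType R).

Definition bounded_operator (T : {linear H -> H}) :=
  exists M : R, forall v : H, `|T v| <= M%:C * `|v|.

Definition self_adjoint (T : {linear H -> H}) :=
  forall v w : H, inner (T v) w = inner v (T w).

Definition orthogonal_projection (T : {linear H -> H}) :=
  [/\ bounded_operator T, self_adjoint T & T \o T =1 T].

(* The family T sums to S in the strong operator topology: for every vector v,
   the net of the sums of T i v over the finite sets of indices, ordered by
   inclusion, converges to S v in norm. *)
Definition strongly_sums_to (I : choiceType) (T : I -> {linear H -> H})
    (S : H -> H) :=
  forall v : H, partial_sum (fun i => T i v) @ totally --> S v.

End Operators.

Section QuantumPermutations.
Variables (R : realType) (H : hilbertType R) (X : choiceType).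
Implicit Types (u : X -> X -> {linear H -> H}) (A : rel X).

Definition quantum_permutation u :=
  [/\ forall x y, orthogonal_projection (u x y),
      forall x, strongly_sums_to (fun y => u x y) idfun,
      forall x, strongly_sums_to (fun y => u y x) idfun
    & forall x y a b, (x, y) <> (a, b) -> x = a \/ y = b ->
        u x y \o u a b =1 \0].

Definition quantum_automorphism A u :=
  quantum_permutation u /\
  (forall x1 x2 y1 y2, A x1 x2 != A y1 y2 -> u x1 y1 \o u x2 y2 =1 \0).

End QuantumPermutations.

(* The adjacency matrix of a graph is a boolean relation on its vertices. *)
Definition simple_graph (V : choiceType) (A : rel V) :=
  symmetric A /\ irreflexive A.

Definition extension_property (V : choiceType) (A : rel V) :=
  forall U W : {fset V}, [disjoint U & W]%fset ->
    exists i : V, [/\ i \notin (U `|` W)%fset,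
      forall u, u \in U -> A i u & forall w, w \in W -> ~~ A i w].

(* The Rado graph is determined up to isomorphism, so "being the Rado graph" is
   a property of a graph; taking U and W empty, then U growing, shows that its
   vertex set is infinite. *)
Definition rado_graph (V : choiceType) (A : rel V) :=
  [/\ countable [set: V], simple_graph A & extension_property A].

(* Main.v *)
Require Import Defs.
From mathcomp Require Import all_boot all_order all_algebra.
From mathcomp Require Import all_classical all_reals all_analysis.
From mathcomp Require Import finmap complex summability sesquilinear.

Set Implicit Arguments.
Unset Strict Implicit.
Unset Printing Implicit Defensive.

Import Order.TTheory GRing.Theory Num.Theory.
Import numFieldNormedType.Exports.

Local Open Scope classical_set_scope.
Local Open Scope ring_scope.

(** Write [a_S x] for the sum of the projections [u x y] over [y] in a finite
    set [S] of vertices.  The engine of the proof is that [a_S x] and [a_S s]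
    commute for all [x] and [s].  For a vertex [i] with neighbourhood [N(i)],
    the relations of a quantum automorphism give, at least formally,

      sum of [u p i] over [p] adjacent to [x] = sum of [u x w] over [w] in N(i).

    On the left all projections lie in the single column [i], where they are
    mutually orthogonal; so the left-hand sides for [x] and for [s] commute.
    By the extension property, [i] can be chosen so that N(i) meets a given
    large finite set exactly in [S]; on a fixed vector the right-hand side is
    then close to [a_S x].  [neighbour_sum_approx] makes this precise with
    finite partial sums of the left-hand side, so that no infinite sum of
    projections has to be constructed, and [fset_projections_comm] passes to
    the limit, the partial sums being contractions.

    Take [S = {y, t}] with [y <> t] and [x <> s].  Since products of distinct
    projections in one row or column vanish, commutation of [a_S x] with [a_S s]
    reads

      u_xy u_st + u_xt u_sy = u_sy u_xt + u_st u_xy.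

    Multiplying by u_xy on the left gives u_xy u_st = u_xy u_st u_xy, and on the
    right u_xy u_st u_xy = u_st u_xy; hence u_xy and u_st commute.  When
    [x = s] or [y = t] the two projections are equal or orthogonal. *)

#[local] Existing Instance totally_filter.

Lemma partial_sum_seq (I : choiceType) (M : zmodType) (f : I -> M)
    (G : {fset I}) :
  partial_sum f G = \sum_(p <- G) f p.
Proof. by rewrite /partial_sum big_seq_fsetE. Qed.

Section OrthogonalProjections.
Variables (R : realType) (H : hilbertType R) (I : choiceType).
Variable e : I -> {linear H -> H}.
Hypothesis eP : forall p, orthogonal_projection (e p).
Hypothesis e_orth : forall p q, p != q -> e p \o e q =1 \0.

Lemma sum_projectionsB (G : {fset I}) (B : pred I) v w :
  \sum_(p <- G | B p) e p (v - w) =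
  \sum_(p <- G | B p) e p v - \sum_(p <- G | B p) e p w.
Proof. by rewrite -sumrB; apply: eq_bigr => p _; rewrite linearB. Qed.

Lemma sum_projections_comp (G : {fset I}) (B C : pred I) v :
  \sum_(p <- G | B p) e p (\sum_(q <- G | C q) e q v) =
  \sum_(p <- G | B p && C p) e p v.
Proof.
rewrite big_mkcondr /= big_seq_cond [RHS]big_seq_cond.
apply: eq_bigr => p /andP[Gp _].
rewrite linear_sum big_mkcond (big_fsetD1 p) //= big1_fset ?addr0.
  by case: ifP => // _; have [_ _ /(_ v)] := eP p.
move=> q; rewrite in_fsetD1 => /andP[qp _] _.
by case: ifP => // _; apply: (e_orth _ v); rewrite eq_sym.
Qed.

Lemma sum_projections_comm (G : {fset I}) (B C : pred I) v :
  \sum_(p <- G | B p) e p (\sum_(q <- G | C q) e q v) =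
  \sum_(p <- G | C p) e p (\sum_(q <- G | B q) e q v).
Proof.
by rewrite !sum_projections_comp; apply: eq_bigl => p; rewrite andbC.
Qed.

(** A finite sum [P] of mutually orthogonal projections is self-adjoint and
    idempotent, so [P v] and [v - P v] are orthogonal and Pythagoras applies. *)
Lemma sum_projections_contraction (G : {fset I}) (B : pred I) v :
  `|\sum_(p <- G | B p) e p v| <= `|v|.
Proof.
set P := fun v => \sum_(p <- G | B p) e p v.
rewrite -[leLHS]/(`|P v|).
have PP : P (P v) = P v.
  by rewrite /P sum_projections_comp; apply: eq_bigl => p; rewrite andbb.
have P_adj a b : inner (P a) b = inner a (P b).
  rewrite /P linear_sumlz linear_sumr; apply: eq_bigr => p _.
  by have [_ + _] := eP p; apply.
have vE : inner v v = inner (P v) (P v) + inner (v - P v) (v - P v).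
  have PvD : inner (P v) (v - P v) = 0.
    rewrite P_adj {1}/P sum_projectionsB -/(P v) -/(P (P v)) PP.
    by rewrite subrr linear0r.
  rewrite -{1 2}(subrK (P v) v) addrC.
  by rewrite (hnormDd PvD).
rewrite -(@ler_pXn2r _ 2) ?nnegrE //.
by rewrite !inner_norm vE lerDl -inner_norm exprn_ge0.
Qed.

End OrthogonalProjections.

Lemma extension_neighbourhood (V : choiceType) (A : rel V) (S F : {fset V}) :
  extension_property A ->
  exists i, forall w, w \in F -> A i w = (w \in S).
Proof.
have SF : [disjoint S & F `\` S]%fset.
  by apply/fdisjointP => w Sw; rewrite in_fsetD Sw.
move=> /(_ _ _ SF)[i [_ iS iF]]; exists i => w Fw.
case: (boolP (w \in S)) => [/iS //|Sw].
by apply/negbTE/iF; rewrite in_fsetD Sw.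
Qed.

Section ExtensionGraph.
Variables (R : realType) (V : choiceType) (A : rel V) (H : hilbertType R).
Variable u : V -> V -> {linear H -> H}.
Hypothesis hA : extension_property A.
Hypothesis hu : quantum_automorphism A u.

Lemma quantum_automorphism_row_orth x y z v : y != z -> u x y (u x z v) = 0.
Proof.
move=> yz; have [[_ _ _ orth] _] := hu.
apply: (orth x y x z _ _ v); last by left.
by move=> [E]; rewrite E eqxx in yz.
Qed.

Lemma quantum_automorphism_col_orth i p q : p != q -> u p i \o u q i =1 \0.
Proof.
move=> pq; have [[_ _ _ orth] _] := hu; apply: orth; last by right.
by move=> [E]; rewrite E eqxx in pq.
Qed.

(** Nothing is asked of the neighbourhood of [i] outside [F]: since row [x] sums
    to the identity, [F] can be taken so large that the vectors [u x w v] with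
    [w] outside [F] contribute little to [v].  The set [F] is chosen before [i],
    so that several such estimates can share one vertex [i]. *)
Lemma neighbour_sum_approx (S : {fset V}) x v (eps : R[i]) : 0 < eps ->
  exists F : {fset V}, forall i,
    (forall w, w \in F -> A i w = (w \in S)) ->
  \forall G \near totally,
    `|\sum_(p <- enum_fset G | A p x) u p i v - \sum_(w <- S) u x w v| < eps.
Proof.
move=> eps0; have e2 : 0 < eps / 2 by rewrite divr_gt0.
have [[uP row col orth] uA] := hu.
have /cvgrPdist_lt /(_ _ e2) := row x v.
case=> F0 _ F0v; exists (F0 `|` S)%fset; set F := (F0 `|` S)%fset => i iF.
have {F0v} Fv : `|v - \sum_(w <- F) u x w v| < eps / 2.
  by rewrite -partial_sum_seq; apply: F0v; rewrite /= fsubsetUl.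
set a := \sum_(w <- S) u x w v.
(* [u p i] kills [u x w] when exactly one of [A p x], [A i w] holds: this
   discards the [w] outside [S] on the left and the [p] not adjacent to [x] on
   the right, leaving a full sum over column [i], which converges to [a]. *)
have aE G : \sum_(p <- G | A p x) u p i (\sum_(w <- F) u x w v) =
    \sum_(p <- G) u p i a.
  rewrite big_mkcond; apply: eq_bigr => p _; rewrite /a !linear_sum /=.
  case: ifPn => Apx.
    apply/esym/big_fset_incl; first exact: fsubsetUr.
    move=> w Fw Sw; apply: (uA p x i w _ v).
    by rewrite Apx iF // (negbTE Sw).
  rewrite big_seq big1 // => w Sw; apply: (uA p x i w _ v).
  by rewrite (negbTE Apx) iF ?Sw // in_fsetU Sw orbT.
have /cvgrPdist_lt /(_ _ e2) := col i a.
apply: filterS => G; rewrite partial_sum_seq -aE => aG.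
set P := fun v => \sum_(p <- G | A p x) u p i v in aG *.
rewrite -[X in `|X - a|]/(P v) -(subrKA (P (\sum_(w <- F) u x w v))).
rewrite /P -sum_projectionsB -/(P _).
rewrite [eps]splitr (le_lt_trans (ler_normD _ _)) // ltrD //; last first.
  by rewrite distrC.
apply: le_lt_trans Fv.
exact: (sum_projections_contraction (fun p => uP p i)
  (@quantum_automorphism_col_orth i)).
Qed.

(** Both sides are approximated by the product, in either order, of two
    neighbour sums taken in one column [i], and there the order is immaterial. *)
Lemma fset_projections_comm (S : {fset V}) x s v :
  \sum_(y <- S) u x y (\sum_(t <- S) u s t v) =
  \sum_(t <- S) u s t (\sum_(y <- S) u x y v).
Proof.
pose b r v := \sum_(w <- S) u r w v; rewrite -[LHS]/(b x (b s v)).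
rewrite -[RHS]/(b s (b x v)).
apply/eqP; rewrite -subr_eq0 -normr_le0; apply/ler_addgt0Pl => eps eps0.
rewrite addr0.
(* Each of the two products needs one estimate per factor, hence four quarters
   of [eps]. *)
have e0 : 0 < eps / 2 / 2 by rewrite !divr_gt0.
have [F1 h1] := neighbour_sum_approx S s v e0.
have [F2 h2] := neighbour_sum_approx S x v e0.
have [F3 h3] := neighbour_sum_approx S x (b s v) e0.
have [F4 h4] := neighbour_sum_approx S s (b x v) e0.
pose F := (F1 `|` F2 `|` (F3 `|` F4))%fset.
have [i iF] := extension_neighbourhood S F hA.
have iF1 w : w \in F1 -> A i w = (w \in S).
  by move=> Fw; apply: iF; rewrite !in_fsetU Fw.
have iF2 w : w \in F2 -> A i w = (w \in S).
  by move=> Fw; apply: iF; rewrite !in_fsetU Fw orbT.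
have iF3 w : w \in F3 -> A i w = (w \in S).
  by move=> Fw; apply: iF; rewrite !in_fsetU Fw !orbT.
have iF4 w : w \in F4 -> A i w = (w \in S).
  by move=> Fw; apply: iF; rewrite !in_fsetU Fw !orbT.
have [G [[g1 g2] [g3 g4]]] := filter_ex (filterI
  (filterI (h1 i iF1) (h2 i iF2)) (filterI (h3 i iF3) (h4 i iF4))).
pose P r w := \sum_(p <- G | A p r) u p i w.
have uP p : orthogonal_projection (u p i) by have [[+ _ _ _] _] := hu; apply.
have P_le r w : `|P r w| <= `|w|.
  exact: (sum_projections_contraction uP (@quantum_automorphism_col_orth i)).
have P_comm : P x (P s v) = P s (P x v).
  exact: (sum_projections_comm uP (@quantum_automorphism_col_orth i)).
have approx r r' w : `|P r' w - b r' w| < eps / 2 / 2 ->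
    `|P r (b r' w) - b r (b r' w)| < eps / 2 / 2 ->
    `|P r (P r' w) - b r (b r' w)| < eps / 2.
  move=> w1 w2; rewrite -(subrKA (P r (b r' w))).
  rewrite [eps / 2]splitr (le_lt_trans (ler_normD _ _)) // ltrD //.
  by rewrite /P -sum_projectionsB (le_lt_trans (P_le _ _)).
rewrite -(subrKA (P x (P s v))) [eps]splitr ltW //.
rewrite (le_lt_trans (ler_normD _ _)) // ltrD //.
  by rewrite distrC approx.
by rewrite P_comm approx.
Qed.

End ExtensionGraph.

Theorem theorem3p1 (R : realType) (V_R : choiceType) (A : rel V_R)
    (hA : rado_graph A) (H : hilbertType R)
    (u : V_R -> V_R -> {linear H -> H}) (hu : quantum_automorphism A u)
    (x y s t : V_R) :
  u x y \o u s t =1 u s t \o u x y.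
Proof.
move=> v /=; have [_ _ ext] := hA.
have [xs|xs] := eqVneq x s.
  have [->|yt] := eqVneq y t; first by rewrite xs.
  rewrite -xs !(quantum_automorphism_row_orth hu) //.
  by rewrite eq_sym.
have [<-|yt] := eqVneq y t.
  rewrite [LHS](quantum_automorphism_col_orth hu y xs v).
  rewrite eq_sym in xs.
  by rewrite [RHS](quantum_automorphism_col_orth hu y xs v).
have col_orth i w : u x i (u s i w) = 0.
  exact: (quantum_automorphism_col_orth hu i xs w).
have col_orth' i w : u s i (u x i w) = 0.
  by rewrite eq_sym in xs; apply: (quantum_automorphism_col_orth hu i xs w).
have row_orth w : u x y (u x t w) = 0.
  exact: (quantum_automorphism_row_orth hu).
have row_orth' w : u x t (u x y w) = 0.
  by apply: (quantum_automorphism_row_orth hu); rewrite eq_sym.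
have idem w : u x y (u x y w) = u x y w.
  by have [[+ _ _ _] _] := hu => /(_ x y)[_ _ /(_ w)].
have sum_yt (f : V_R -> H) : \sum_(w <- [fset y; t]%fset) f w = f y + f t.
  by rewrite (big_fsetD1 y) ?fset21 //= fsetU1K ?inE // big_seq_fset1.
have comm w : u x y (u s t w) + u x t (u s y w) =
              u s y (u x t w) + u s t (u x y w).
  have := fset_projections_comm ext hu [fset y; t]%fset x s w.
  by rewrite !sum_yt !linearD /= !col_orth !col_orth' !add0r !addr0.
have left_cut : u x y (u s t v) = u x y (u s t (u x y v)).
  have := congr1 (u x y) (comm v).
  by rewrite !linearD /= idem row_orth col_orth addr0 add0r.
have right_cut : u x y (u s t (u x y v)) = u s t (u x y v).
  have := comm (u x y v).
  by rewrite idem row_orth' linear0 col_orth' linear0 add0r addr0.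
by rewrite left_cut right_cut.
Qed.
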